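(* Let $K$ be a field of characteristic zero and let $G=\bigoplus_{i=0}^{D}G_i\cong K[x_1,\ldots,x_n]/I$ be a standard graded Gorenstein Artinian $K$-algebra of socle degree $D$ and codimension $n=\dim_K G_1\ge 1$ ($I$ a homogeneous ideal) that has the Weak Lefschetz property (WLP). Then, for every $l\in\{1,\ldots,n\}$, the quotient ring $$A=\frac{G}{(0:_G x_l)}$$ is also a standard graded Gorenstein Artinian $K$-algebra. Moreover, assume that $A$ and $G$ have the same codimension and let $k:=\lfloor D/2\rfloor$. Then: 1. If $D$ is odd, then $A$ also has the WLP. 2. If $D$ is even and $\dim_K(G_{k-1})=\dim_K(G_k)$, then $A$ also has the WLP.
   Context: A standard graded Artinian $K$-algebra $A=\bigoplus_{i=0}^{D}A_i$ (with $A_0=K$, generated by $A_1$, finite-dimensional over $K$, $A_D\neq 0$) has codimension $\dim_K A_1$; when a presentation $A\cong K[x_1,\ldots,x_n]/I$ is written, $n$ is the codimension. $A$ has the Weak Lefschetz property (WLP) if there is $L\in A_1$ such that the multiplication map $\times L:A_i\to A_{i+1}$ has maximal rank (is injective or surjective) for every $i=0,\ldots,D-1$. For Gorenstein $A=\bigoplus_{i=0}^D A_i$ with $A_D\ne0$, $D$ is the socle degree of $A$. $(0:_G x_l)=\{g\in G: g x_l=0\}$, where $x_l$ denotes also its image in $G$. *)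

(* Defs.v *)
From HB Require Import structures.
From mathcomp Require Import all_boot all_order all_algebra falgebra.
From mathcomp Require Import mpoly.

Set Implicit Arguments.
Unset Strict Implicit.
Unset Printing Implicit Defensive.

Import GRing.Theory.
Local Open Scope ring_scope.
Local Open Scope quotient_scope.

#[short(type="comFalgType")]
HB.structure Definition ComFalgebra (K : fieldType) :=
  { A of Falgebra K A & GRing.ComUnitAlgebra K A }.

(* MathComp provides {ideal_quot I} only as a commutative ring; for an ideal
   of a commutative K-algebra it is again a K-algebra. *)
Section QuotientAlgebra.
Variables (K : fieldType) (R : comAlgType K) (I : idealr R).
Local Notation Q := {ideal_quot I}.

Definition quot_scale (a : K) (q : Q) : Q := \pi_Q (a *: repr q).

Lemma ideal_scale (a : K) (u : R) : u \in I -> a *: u \in I.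
Proof. by move=> Iu; rewrite -[u]mul1r scalerAl idealMr. Qed.

Lemma quot_scaleE (a : K) (u : R) : quot_scale a (\pi_Q u) = \pi_Q (a *: u).
Proof.
apply/eqP; rewrite -Quotient.idealrBE -scalerBr ideal_scale //.
by rewrite Quotient.idealrBE reprK.
Qed.

Lemma quot_piD (u v : R) : \pi_Q (u + v) = \pi_Q u + \pi_Q v.
Proof. exact: (Quotient.pi_add I). Qed.

Lemma quot_piM (u v : R) : \pi_Q (u * v) = \pi_Q u * \pi_Q v.
Proof. exact: (Quotient.pi_mul I). Qed.

Lemma quot_scaleA a b q : quot_scale a (quot_scale b q) = quot_scale (a * b) q.
Proof.
by elim/quotW: q => u; rewrite (quot_scaleE b) !quot_scaleE scalerA.
Qed.

Lemma quot_scale1 : left_id 1 quot_scale.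
Proof. by elim/quotW=> u; rewrite quot_scaleE scale1r. Qed.

Lemma quot_scaleDr : right_distributive quot_scale +%R.
Proof.
move=> a; elim/quotW=> u; elim/quotW=> v; rewrite -quot_piD !quot_scaleE.
by rewrite scalerDr quot_piD.
Qed.

Lemma quot_scaleDl q : {morph quot_scale^~ q : a b / a + b}.
Proof.
by elim/quotW: q => u a b; rewrite !quot_scaleE scalerDl quot_piD.
Qed.

HB.instance Definition _ := GRing.Zmodule_isLmodule.Build K Q
  quot_scaleA quot_scale1 quot_scaleDr quot_scaleDl.

Lemma quot_scaleAl (a : K) (p q : Q) : a *: (p * q) = a *: p * q.
Proof.
elim/quotW: p => u; elim/quotW: q => v; rewrite -quot_piM.
rewrite [LHS]quot_scaleE [_ *: \pi_Q u]quot_scaleE -quot_piM.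
by rewrite scalerAl.
Qed.

HB.instance Definition _ := GRing.Lmodule_isLalgebra.Build K Q quot_scaleAl.
HB.instance Definition _ := GRing.Lalgebra_isComAlgebra.Build K Q.

Lemma quot_pi_scalable : scalable (\pi_Q : R -> Q).
Proof. by move=> a u; rewrite -quot_scaleE. Qed.

HB.instance Definition _ :=
  GRing.isScalable.Build K R Q *:%R \pi_Q quot_pi_scalable.

End QuotientAlgebra.

Section AnnihilatorQuotient.
Variables (K : fieldType) (G : comFalgType K) (x : G).

(* MathComp rings being nontrivial, the ideal (0 :_G x) has to be proper for
   the quotient to be formed: hence the hypothesis x != 0. *)
Definition ann_ideal (x_neq0 : x != 0) : {pred G} := fun g => g * x == 0.

Variable x_neq0 : x != 0.

Lemma ann_ideal_idealr : idealr_closed (ann_ideal x_neq0).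
Proof.
split; rewrite ?unfold_in ?mul0r ?mul1r //.
move=> a u v; rewrite !unfold_in => /eqP ux0 /eqP vx0.
by rewrite mulrDl -mulrA ux0 vx0 mulr0 addr0.
Qed.

HB.instance Definition _ := isIdealr.Build G (ann_ideal x_neq0) ann_ideal_idealr.

Definition ann_quot : Type := {ideal_quot (ann_ideal x_neq0)}.

HB.instance Definition _ := GRing.ComAlgebra.on ann_quot.

Definition ann_proj : G -> ann_quot := \pi_{ideal_quot (ann_ideal x_neq0)}.

HB.instance Definition _ := GRing.LRMorphism.on ann_proj.

Lemma ann_proj_eq0 (g : G) : (ann_proj g == 0) = (g * x == 0).
Proof.
rewrite -(rmorph0 ann_proj).
have := Quotient.idealrBE (ann_ideal x_neq0) g 0.
by rewrite subr0 unfold_in => ->.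
Qed.

Lemma ann_proj_surj (q : ann_quot) : exists g, ann_proj g = q.
Proof. by exists (repr q); rewrite /ann_proj reprK. Qed.

(* G / (0 :_G x) is finite-dimensional: g |-> g * x identifies it with the
   image of multiplication by x. *)
Lemma ann_quot_vect : Vector.axiom (\dim (limg (amulr x))) ann_quot.
Proof.
pose W := limg (amulr x).
pose f (q : ann_quot) : subvs_of W := vsproj W (repr q * x).
have fE g : f (ann_proj g) = vsproj W (g * x).
  congr (vsproj W _); apply/eqP; rewrite -subr_eq0 -mulrBl -ann_proj_eq0.
  by rewrite rmorphB /= /ann_proj reprK subrr.
have f_lin : linear f.
  move=> a p q; have [u <-] := ann_proj_surj p; have [v <-] := ann_proj_surj q.
  by rewrite -linearP !fE -linearP mulrDl scalerAl.
have W_mulx g : g * x \in W.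
  by apply/memv_imgP; exists g; rewrite ?memvf // lfunE.
have f_inj : injective f.
  move=> p q; have [u <-] := ann_proj_surj p; have [v <-] := ann_proj_surj q.
  rewrite !fE => /(congr1 vsval); rewrite !vsprojK // => uv.
  by apply/eqP; rewrite -subr_eq0 -rmorphB /= ann_proj_eq0 mulrBl uv subrr.
have f_bij : bijective f.
  have wP (w : subvs_of W) : exists g : G, g * x == vsval w.
    have /memv_imgP[g _ ->] := subvsP w.
    by exists g; rewrite lfunE.
  exists (fun w => ann_proj (xchoose (wP w))) => [q|w].
    apply: f_inj; rewrite fE; apply: val_inj.
    rewrite /= vsprojK // (eqP (xchooseP (wP _))).
    by rewrite vsprojK.
  rewrite fE; apply: val_inj; rewrite /= vsprojK //.
  exact: (eqP (xchooseP (wP w))).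
have [r r_lin r_bij] : Vector.axiom (\dim W) (subvs_of W).
  exact: subvs_vect_iso.
exists (r \o f); last exact: bij_comp.
by move=> a p q; rewrite /= f_lin r_lin.
Qed.

HB.instance Definition _ := Lmodule_hasFinDim.Build K ann_quot ann_quot_vect.
HB.instance Definition _ := Algebra_isFalgebra.Build K ann_quot.

End AnnihilatorQuotient.

Section Graded.
Variables (K : fieldType) (A : comFalgType K).
Implicit Types (gr : nat -> {vspace A}) (D : nat).

(* A grading is the family of its pieces A_i as subspaces of A, with A_i = 0
   for i > D; since A_D != 0, D is determined by gr. *)
Record standard_graded gr D : Prop := StandardGraded {
  graded_one : gr 0%N = 1%VS;
  graded_mul : forall i j, (gr i * gr j <= gr (i + j)%N)%VS;
  graded_full : (\sum_(i < D.+1) gr i)%VS = fullv;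
  graded_direct : directv (\sum_(i < D.+1) gr i);
  graded_gen : agenv (gr 1%N) = fullv;
  graded_top : gr D != 0%VS;
  graded_above : forall i, (D < i)%N -> gr i = 0%VS
}.

Definition irrelevant_ideal gr D : {vspace A} := (\sum_(1 <= i < D.+1) gr i)%VS.

Definition socle gr D : {vspace A} :=
  (\bigcap_(a <- vbasis (irrelevant_ideal gr D)) lker (amull a))%VS.

Lemma socleP gr D (s : A) :
  reflect (forall a, a \in irrelevant_ideal gr D -> a * s = 0)
          (s \in socle gr D).
Proof.
have amE (a : A) : (s \in lker (amull a)) = (a * s == 0).
  by rewrite memv_ker lfunE.
apply: (iffP idP) => [soc a /coord_vbasis -> | soc].
  rewrite mulr_suml big1 // => i _; rewrite -scalerAl.
  set b := vbasis _ in soc *.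
  suff /eqP -> : b`_i * s == 0 by rewrite scaler0.
  have bi : b`_i \in b by rewrite mem_nth ?size_tuple.
  rewrite -amE; move: soc; rewrite /socle -/b (big_rem _ bi) /=.
  by rewrite memv_cap => /andP[].
rewrite memvE /socle big_tnth; apply/subv_bigcapP => j _.
by rewrite -memvE amE soc // vbasis_mem // mem_tnth.
Qed.

(* For a graded Artinian algebra with A_0 = K, being Gorenstein means that
   the socle (0 :_A A_+) has dimension one over K. *)
Definition gorenstein gr D : Prop := \dim (socle gr D) = 1%N.

Definition maximal_rank gr (L : A) (i : nat) : Prop :=
  {in gr i &, injective (fun a => L * a)} \/ (amull L @: gr i)%VS = gr i.+1.

Definition weak_lefschetz gr D : Prop :=
  exists2 L, L \in gr 1%N & forall i, (i < D)%N -> maximal_rank gr L i.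

End Graded.

Definition homogeneous_ideal (K : fieldType) n (I : {pred {mpoly K[n]}}) : Prop :=
  forall p d, p \in I -> pihomog mdeg d p \in I.

Section Presentation.
Variables (K : fieldType) (n : nat) (I : idealr {mpoly K[n]}).
Variables (G : comFalgType K) (gr : nat -> {vspace G}).
Variable phi : {lrmorphism {ideal_quot I} -> G}.

(* phi : K[x_1, .., x_n]/I -> G is an isomorphism of graded algebras. *)
Record graded_presentation : Prop := GradedPresentation {
  presentation_homog : homogeneous_ideal I;
  presentation_bij : bijective phi;
  presentation_grading : forall d (g : G),
    g \in gr d <->
    exists2 p : {mpoly K[n]}, p \is d.-homog & g = phi (\pi_{ideal_quot I} p)
}.

Definition var_image (l : 'I_n) : G := phi (\pi_{ideal_quot I} 'X_l).

Lemma var_image_neq0 (l : 'I_n) :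
  \dim (gr 1%N) = n -> graded_presentation -> var_image l != 0.
Proof.
move=> dim1 [_ _ grP]; pose X := [tuple var_image i | i < n].
have sub1 : (gr 1%N <= <<X>>)%VS.
  apply/subvP => g /grP[p /dhomogP p1 ->].
  rewrite [p]mpolyE !raddf_sum /= big_seq; apply: memv_suml => m /p1 /eqP.
  case/mdeg1P => i /eqP ->; rewrite !linearZ /=; apply/memvZ/memv_span.
  by apply/mapP; exists i; rewrite ?mem_enum.
have freeX : free X.
  rewrite /free eqn_leq dim_span size_tuple -[X in (X <= _)%N]dim1.
  exact: dimvS.
apply: (free_not0 freeX).
by apply/mapP; exists l; rewrite ?mem_enum.
Qed.

End Presentation.

Section QuotientGrading.
Variables (K : fieldType) (G : comFalgType K) (x : G) (x_neq0 : x != 0).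

(* G_i maps onto the degree i piece of the quotient by a homogeneous ideal. *)
Definition quot_grading (gr : nat -> {vspace G}) : nat -> {vspace ann_quot x_neq0} :=
  fun i => (linfun (ann_proj x_neq0) @: gr i)%VS.

End QuotientGrading.

(* Main.v *)
Require Import Defs.
From HB Require Import structures.
From mathcomp Require Import all_boot all_order all_algebra falgebra.
From mathcomp Require Import mpoly.

Set Implicit Arguments.
Unset Strict Implicit.
Unset Printing Implicit Defensive.

Import GRing.Theory.
Local Open Scope ring_scope.

(* Every nonzero homogeneous element of a graded Gorenstein algebra G is
   multiplied to a nonzero socle element by some element of complementary
   degree.  Hence multiplication by L is surjective from degree i to i + 1 only
   if it is injective from degree D - 1 - i to D - i, and since surjectivity
   propagates upwards, a single surjection in degree m <= D / 2 gives the weak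
   Lefschetz property.  Multiplication by x embeds G / (0 : x) into G, which
   transfers the grading and the one-dimensional socle, and lowers the socle
   degree by one; a surjection of G in degree m descends to G / (0 : x).  The
   WLP of G provides one with m = k if D = 2k + 1, as dim G_k = dim G_(k+1), and
   with m = k - 1 if D = 2k and dim G_(k-1) = dim G_k. *)

Lemma vspace_dim1 (K : fieldType) (V : vectType K) (U : {vspace V}) v :
  \dim U = 1%N -> v \in U -> v != 0 -> U = <[v]>%VS.
Proof.
move=> U1 Uv v0; apply/esym/eqP.
by rewrite -(dimv_leqif_eq (_ : <[v]> <= U)%VS) ?dim_vline ?v0 ?U1 // -memvE.
Qed.

(** * Standard graded algebras: degrees, socle and propagation of surjectivity *)

Section GradedTheory.
Variables (K : fieldType) (A : comFalgType K) (gr : nat -> {vspace A}) (D : nat).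
Hypothesis std : standard_graded gr D.

Lemma graded_memM i j a b : a \in gr i -> b \in gr j -> a * b \in gr (i + j)%N.
Proof.
move=> ai bj; apply: (subvP (graded_mul std i j)); exact: memv_mul.
Qed.

Lemma graded_independent (u : nat -> A) :
    (forall i, (i <= D)%N -> u i \in gr i) ->
  \sum_(i < D.+1) u i = 0 -> forall i, (i <= D)%N -> u i = 0.
Proof.
move=> u_gr u0 i leiD.
have /directv_sum_independent/(_ (fun j : 'I_D.+1 => u j)) := graded_direct std.
move=> /(_ _ u0 (Ordinal (leiD : i < D.+1)%N)); apply=> // j _.
by apply: u_gr; rewrite -ltnS.
Qed.

Lemma graded_disjoint i j a : i != j -> a \in gr i -> a \in gr j -> a = 0.
Proof.
move=> neq_ij ai aj.
have [ltDi | leiD] := ltnP D i.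
  by move: ai; rewrite (graded_above std ltDi) memv0 => /eqP.
have [ltDj | lejD] := ltnP D j.
  by move: aj; rewrite (graded_above std ltDj) memv0 => /eqP.
(* A family with [a] in degree [i] and [- a] in degree [j] sums to zero, so independence kills
   [a]. *)
pose u k := if k == i then a else if k == j then - a else 0.
have -> : a = u i by rewrite /u eqxx.
apply: (graded_independent (u := u)) => [k _||//].
  rewrite /u; case: (k =P i) => [-> //|_].
  by case: (k =P j) => [->|_]; rewrite ?memvN ?mem0v.
rewrite (bigD1 (Ordinal (leiD : i < D.+1)%N)) //=.
rewrite (bigD1 (Ordinal (lejD : j < D.+1)%N)) /=; last first.
  by apply: contra neq_ij => /eqP[->].
rewrite big1 => [|k /andP[ki kj]].
  by rewrite /u !eqxx eq_sym (negPf neq_ij) addr0 subrr.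
have /negPf ki' : (k : nat) != i by [].
have /negPf kj' : (k : nat) != j by [].
by rewrite /u ki' kj'.
Qed.

(** The sum of the subspaces [W j] of [gr j] contains 1 and is stable under multiplication by
    [gr 1], so by generation in degree one it is the whole algebra. *)
Lemma graded_succ i : gr i.+1 = (gr 1%N * gr i)%VS.
Proof.
pose W j := if j is j'.+1 then (gr 1%N * gr j')%VS else 1%VS.
have W_gr j : (W j <= gr j)%VS.
  by case: j => [|j] /=; [rewrite (graded_one std) | exact: (graded_mul std 1)].
have W_full : (\sum_(j < D.+1) W j)%VS = fullv.
  apply/eqP; rewrite eqEsubv subvf /= -(graded_gen std); apply: agenv_sub_modl.
    exact: (sumv_sup ord0).
  rewrite big_distrr /=; apply/subv_sumP => j _.
  have sub_W : (gr 1%N * W j <= W j.+1)%VS by apply: prodvSr.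
  have [ltjD | leDj] := ltnP j D.
    by apply: (sumv_sup (Ordinal (ltjD : j.+1 < D.+1)%N)).
  apply: subv_trans sub_W _; apply: subv_trans (W_gr _) _.
  by rewrite (graded_above std) ?sub0v.
have [ltDi | leiD] := ltnP D i.+1.
  apply/eqP; rewrite eqEsubv (graded_mul std 1) andbT.
  by rewrite (graded_above std ltDi) sub0v.
(* Both families fill the algebra and the [gr j] are independent, so the total dimensions agree,
   which forces equality in each degree. *)
have dimW (j : 'I_D.+1) : true ->
    (\dim (W j) <= \dim (gr j) ?= iff (gr j <= W j)%VS)%N.
  by move=> _; apply: dimv_leqif_sup.
have dim_sum : (\sum_(j < D.+1) \dim (W j) = \sum_(j < D.+1) \dim (gr j))%N.
  apply/eqP; rewrite eqn_leq (leqif_sum dimW) /=.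
  have /directvP /= <- := graded_direct std.
  by rewrite (graded_full std) -W_full dimv_leq_sum.
have := (leqif_sum dimW).2; rewrite dim_sum eqxx => /esym/forallP.
move=> /(_ (Ordinal (leiD : i.+1 < D.+1)%N)) /= sub_grW.
by apply/eqP; rewrite eqEsubv sub_grW (graded_mul std 1).
Qed.

(** By [graded_succ], every piece of positive degree is a multiple of [gr 1], so testing in degree
    one suffices. *)
Lemma mem_socle (s : A) :
  s \in socle gr D <-> (forall a, a \in gr 1%N -> a * s = 0).
Proof.
split=> [/socleP soc a a1 | ann1].
  have [leD | ltD] := leqP 1 D; last first.
    by move: a1; rewrite (graded_above std ltD) memv0 => /eqP ->; rewrite mul0r.
  apply: soc; apply: (subvP _ a a1).
  by rewrite /irrelevant_ideal big_ltn // addvSl.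
apply/socleP => a irr_a; apply/eqP.
have -> : (a * s == 0) = (a \in lker (amulr s)) by rewrite memv_ker lfunE.
apply: (subvP _ a irr_a); rewrite /irrelevant_ideal big_add1 big_mkord.
apply/subv_sumP => i _; rewrite graded_succ; apply/prodvP => b c b1 _.
by rewrite memv_ker lfunE /= mulrAC ann1 ?mul0r.
Qed.

Lemma top_sub_socle : (gr D <= socle gr D)%VS.
Proof.
apply/subvP => s sD; apply/mem_socle => a a1.
by have := graded_memM a1 sD; rewrite (graded_above std) // memv0 => /eqP.
Qed.

(** G_(i+2) = G_1 G_(i+1) = G_1 L G_i, which lies in L G_(i+1). *)
Lemma surjective_succ L i : L \in gr 1%N ->
    (amull L @: gr i)%VS = gr i.+1 ->
  (amull L @: gr i.+1)%VS = gr i.+2.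
Proof.
move=> L1 surj; apply/eqP; rewrite eqEsubv; apply/andP; split.
  apply/subvP => _ /memv_imgP[a ai ->]; rewrite lfunE /=.
  exact: (graded_memM L1 ai).
rewrite (graded_succ i.+1); apply/prodvP => a b a1 bi.
have /memv_imgP[c ci ->] : b \in (amull L @: gr i)%VS by rewrite surj.
rewrite lfunE /= mulrCA.
have -> : L * (a * c) = amull L (a * c) by rewrite lfunE.
apply: memv_img.
exact: (graded_memM a1 ci).
Qed.

Lemma surjective_above L m i : L \in gr 1%N ->
    (amull L @: gr m)%VS = gr m.+1 -> (m <= i)%N ->
  (amull L @: gr i)%VS = gr i.+1.
Proof.
move=> L1 surj /subnK <-; elim: (i - m)%N => // d; exact: surjective_succ.
Qed.

(** * Gorenstein duality between complementary degrees *)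

Hypothesis gor : gorenstein gr D.

Lemma socle_top : socle gr D = gr D.
Proof.
apply/esym/eqP; rewrite -(dimv_leqif_eq top_sub_socle) gor eqn_leq.
by rewrite -[X in (_ <= X)%N]gor dimvS ?top_sub_socle //= lt0n dimv_eq0 graded_top.
Qed.

(** Below degree [D], an element killed by [gr 1] would lie in the socle, which is [gr D], and so
    vanish; hence some degree one factor keeps it nonzero, and induction on [d] continues. *)
Lemma nonzero_multiple_in_top i d a : (i + d)%N = D -> a \in gr i -> a != 0 ->
  exists2 b, b \in gr d & b * a != 0.
Proof.
elim: d => [|d IHd] in i a *.
  by move=> _ _ a0; exists 1; rewrite ?mul1r // (graded_one std) memv_line.
move=> id_D ai a0.
have [ann1 | ] := boolP (gr 1%N <= lker (amulr a))%VS.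
  case/eqP: a0; have neq_iD : i != D.
    by rewrite -id_D -[X in X != _]addn0 eqn_add2l.
  apply: (graded_disjoint neq_iD ai); rewrite -socle_top.
  apply/mem_socle => c c1; have := subvP ann1 c c1.
  by rewrite memv_ker lfunE /= => /eqP.
case/subvPn => c c1; rewrite memv_ker lfunE /= => ca0.
have [] := IHd _ _ _ (graded_memM c1 ai) ca0; first by rewrite add1n addSnnS.
move=> b bd bca0; exists (b * c); last by rewrite -mulrA.
by rewrite -addn1; exact: graded_memM.
Qed.

(** If [L * a = 0], then [a] is killed by all of L G_i = G_(i+1), the degree complementary to
    [j]. *)
Lemma annihilator_surjective L i j : L \in gr 1%N -> (i + j).+1 = D ->
  (amull L @: gr i)%VS = gr i.+1 -> {in gr j, forall a, L * a = 0 -> a = 0}.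
Proof.
move=> L1 ij_D surj a aj La0; apply/eqP; apply: contraT => a0.
have [] := nonzero_multiple_in_top (d := i.+1) _ aj a0.
  by rewrite addnS addnC.
move=> b; rewrite -surj => /memv_imgP[c _ ->].
by rewrite lfunE /= mulrAC La0 mul0r eqxx.
Qed.

(** The product pairs [gr i] with [gr j] into the line [gr D], and no nonzero element of [gr i]
    pairs to zero with all of [gr j]. *)
Lemma dim_complementary_le i j : (i + j)%N = D -> (\dim (gr i) <= \dim (gr j))%N.
Proof.
move=> ij_D; pose s := vpick (socle gr D).
have soc_s : socle gr D = <[s]>%VS.
  by apply: vspace_dim1; rewrite ?memv_pick // vpick0 -dimv_eq0 gor.
pose X := [tuple s]; pose B := vbasis (gr j).
(* [f a] lists the pairings of [a] with a basis of [gr j], as coefficients of the socle generator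
   [s]. *)
pose f a : 'rV[K]_(\dim (gr j)) := \row_t coord X 0 (a * B`_t).
have f_lin : linear f.
  by move=> k a b; apply/rowP => t; rewrite !mxE mulrDl -scalerAl linearP.
pose fl := linfun (HB.pack_for {linear A -> 'rV[K]_(\dim (gr j))} f
  (GRing.isLinear.Build _ _ _ _ f f_lin)).
have flE a : fl a = f a by rewrite lfunE.
rewrite -(@limg_dim_eq _ _ _ fl (gr i)).
  by apply: leq_trans (dimvS (subvf _)) _; rewrite dimvf dim_matrix mul1r.
apply/eqP; rewrite -subv0; apply/subvP => a; rewrite memv_cap memv_ker flE.
case/andP=> ai /eqP fa0; rewrite memv0; apply: contraT => a0.
have [b bj] := nonzero_multiple_in_top ij_D ai a0; case/eqP.
rewrite (coord_vbasis bj) mulr_suml big1 // => t _; rewrite -scalerAl mulrC.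
have aBt : a * B`_t \in <<X>>%VS.
  rewrite span_seq1 -soc_s socle_top -ij_D; apply: graded_memM => //.
  by rewrite vbasis_mem // mem_nth // size_tuple.
have := congr1 (fun v : 'rV_ _ => v 0 t) fa0; rewrite !mxE => c0.
by rewrite (coord_span aBt) big_ord1 c0 scale0r scaler0.
Qed.

Lemma weak_lefschetz_of_surjective L m : L \in gr 1%N -> (m.*2 <= D)%N ->
  (amull L @: gr m)%VS = gr m.+1 -> weak_lefschetz gr D.
Proof.
move=> L1 mD surj; exists L => // i ltiD.
have [le_mi | lt_im] := leqP m i; [right | left].
  exact: surjective_above le_mi.
move=> a b ai bi Lab; apply/eqP; rewrite -subr_eq0; apply/eqP.
(* The degree dual to [i] is at least [m], because [i < m] and [2m <= D]; so [L] is surjective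
   there. *)
apply: (@annihilator_surjective L (D - i.+1)%N i) => //; last 2 first.
- by rewrite memvB.
- by rewrite mulrBr Lab subrr.
- by rewrite -addnS subnK.
apply: surjective_above surj _ => //.
rewrite leq_subRL //; apply: leq_trans mD; rewrite -addnn leq_add2r //.
Qed.

End GradedTheory.

(** * The quotient by (0 : x), for [x] of degree one *)

Section AnnihilatorQuotientTheory.
Variables (K : fieldType) (G : comFalgType K) (gr : nat -> {vspace G}) (D : nat).
Hypothesis std : standard_graded gr D.
Hypothesis gor : gorenstein gr D.
Variables (x : G) (x_neq0 : x != 0).
Hypothesis x1 : x \in gr 1%N.
Local Notation pr := (ann_proj x_neq0).
Local Notation grA := (quot_grading x_neq0 gr).

Lemma mem_quot_grading i q :
  q \in grA i <-> exists2 g, g \in gr i & q = pr g.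
Proof.
split=> [/memv_imgP[g gi ->]|[g gi ->]]; first by exists g; rewrite ?lfunE.
by apply/memv_imgP; exists g; rewrite ?lfunE.
Qed.

Lemma ann_proj_eq (g h : G) : (pr g == pr h) = (g * x == h * x).
Proof. by rewrite -subr_eq0 -rmorphB /= ann_proj_eq0 mulrBl subr_eq0. Qed.

(** Multiplication by [x] raises degrees by one, so [x] already kills [gr D]. *)
Lemma quot_grading_above i : (D <= i)%N -> grA i = 0%VS.
Proof.
move=> leDi; apply/eqP; rewrite -subv0; apply/subvP => q /mem_quot_grading[g gi ->].
rewrite memv0 ann_proj_eq0.
by have := graded_memM std gi x1; rewrite (graded_above std) ?addn1 // memv0.
Qed.

Lemma socle_degree_gt0 : (0 < D)%N.
Proof.
rewrite lt0n; apply: contraNneq x_neq0 => D0.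
by move: x1; rewrite (graded_above std) ?D0 // memv0.
Qed.

(** The class of [g0] shows that the quotient is nonzero in degree [D.-1]; it also generates its
    socle. *)
Lemma top_multiplier : exists2 g0, g0 \in gr D.-1 & g0 * x != 0.
Proof.
apply: (nonzero_multiple_in_top std gor _ x1 x_neq0).
by rewrite add1n prednK ?socle_degree_gt0.
Qed.

Lemma quot_standard_graded : standard_graded grA D.-1.
Proof.
have D_gt0 := socle_degree_gt0.
pose f := AHom (linfun_is_ahom (pr : {lrmorphism G -> ann_quot x_neq0})).
have fE i : grA i = (f @: gr i)%VS by [].
have f_full : (f @: fullv)%VS = fullv.
  apply/eqP; rewrite eqEsubv subvf; apply/subvP => q _.
  have [g <-] := ann_proj_surj q.
  by apply/memv_imgP; exists g; rewrite ?memvf //= lfunE.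
split.
- by rewrite fE (graded_one std) aimg1.
- by move=> i j; rewrite !fE -aimgM limgS // (graded_mul std).
- rewrite prednK // -f_full -(graded_full std) limg_sum big_ord_recr /=.
  by rewrite -fE [X in (_ + X)%VS]quot_grading_above // addv0.
- apply/directv_sum_independent => u u_gr u0 i _.
  have /fin_all_exists2[g g_gr gE] (j : 'I_D.-1.+1) :
      exists2 g, g \in gr j & u j = pr g.
    exact/mem_quot_grading/u_gr.
  (* Multiplying a relation in the quotient by [x] gives one in [G], shifted up by one degree: hence
     [w 0 = 0]. The default 0 of [oapp] is only met beyond degree [D]. *)
  pose w j := if j is j'.+1 then oapp g 0 (insub j') * x else 0.
  have wE (j : 'I_(D.-1.+1)) : w j.+1 = g j * x by rewrite /w valK.
  rewrite gE; apply/eqP; rewrite ann_proj_eq0 -wE; apply/eqP.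
  apply: (graded_independent std); last first.
  - by apply: leq_trans (ltn_ord i) _; rewrite prednK.
  - rewrite big_ord_recl add0r -(prednK D_gt0).
    under eq_bigr => j _ do rewrite wE.
    rewrite -mulr_suml; apply/eqP; rewrite -(ann_proj_eq0 x_neq0) raddf_sum /=.
    by under eq_bigr => j _ do rewrite -gE; rewrite u0.
  case=> [|j] ltjD; first exact: mem0v.
  have ltj : (j < D.-1.+1)%N by rewrite prednK.
  rewrite -[j]/(val (Ordinal ltj)) wE.
  by have := graded_memM std (g_gr (Ordinal ltj)) x1; rewrite addn1.
- by rewrite fE -aimg_agen (graded_gen std).
- have [g0 g0D g0x] := top_multiplier.
  apply: contraNneq g0x => top0; rewrite -(ann_proj_eq0 x_neq0) -memv0 -top0.
  by apply/mem_quot_grading; exists g0.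
by move=> i ltDi; apply: quot_grading_above; rewrite -(prednK D_gt0).
Qed.

(** Multiplication by [x] embeds the socle of the quotient into the socle of [G], which is a
    line. *)
Lemma quot_gorenstein : gorenstein grA D.-1.
Proof.
have stdA := quot_standard_graded.
have [g0 g0D g0x] := top_multiplier.
have soc_mulx g : pr g \in socle grA D.-1 -> g * x \in socle gr D.
  move/(mem_socle stdA) => soc; apply/(mem_socle std) => a a1.
  apply/eqP; rewrite mulrA -(ann_proj_eq0 x_neq0) rmorphM /= soc //.
  by apply/mem_quot_grading; exists a.
have soc0 : pr g0 \in socle grA D.-1.
  by apply: (subvP (top_sub_socle stdA)); apply/mem_quot_grading; exists g0.
suff socE : socle grA D.-1 = <[pr g0]>%VS.
  by rewrite /gorenstein socE dim_vline ann_proj_eq0 g0x.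
apply/eqP; rewrite eqEsubv -memvE soc0 andbT; apply/subvP => q.
have [g <-] := ann_proj_surj q => /soc_mulx.
rewrite (vspace_dim1 gor (soc_mulx _ soc0) g0x) => /vlineP[k gx].
apply/vlineP; exists k; rewrite -linearZ; apply/eqP.
by rewrite ann_proj_eq gx scalerAl.
Qed.

Lemma quot_weak_lefschetz L m : L \in gr 1%N -> (m.*2 <= D.-1)%N ->
  (amull L @: gr m)%VS = gr m.+1 -> weak_lefschetz grA D.-1.
Proof.
move=> L1 mD surj.
have LA1 : pr L \in grA 1%N by apply/mem_quot_grading; exists L.
apply: (weak_lefschetz_of_surjective quot_standard_graded quot_gorenstein LA1 mD).
apply/eqP; rewrite eqEsubv; apply/andP; split; apply/subvP => q.
  case/memv_imgP=> _ /mem_quot_grading[g gm ->] ->; rewrite lfunE /= -rmorphM.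
  by apply/mem_quot_grading; exists (L * g) => //; apply: (graded_memM std L1 gm).
case/mem_quot_grading=> h; rewrite -surj => /memv_imgP[g gm ->] ->.
rewrite lfunE /= rmorphM; apply/memv_imgP; exists (pr g); last by rewrite lfunE.
by apply/mem_quot_grading; exists g.
Qed.

End AnnihilatorQuotientTheory.

(** * From the WLP of [G] to a surjection in a low degree, and the theorem *)

Lemma maximal_rank_surjective (K : fieldType) (A : comFalgType K)
    (gr : nat -> {vspace A}) D L i :
    standard_graded gr D -> L \in gr 1%N -> maximal_rank gr L i ->
    (\dim (gr i.+1) <= \dim (gr i))%N ->
  (amull L @: gr i)%VS = gr i.+1.
Proof.
move=> std L1 [inj|//] le_dim; apply/eqP.
have sub : (amull L @: gr i <= gr i.+1)%VS.
  apply/subvP => _ /memv_imgP[a ai ->]; rewrite lfunE /=.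
  exact: (graded_memM std L1 ai).
(* In the injective case the image has the dimension of [gr i], which is at least that of
   [gr i.+1]. *)
rewrite -(dimv_leqif_eq sub) eqn_leq dimvS //= limg_dim_eq //.
apply/eqP; rewrite -subv0; apply/subvP => a; rewrite memv_cap memv_ker lfunE /=.
by case/andP=> ai /eqP La0; rewrite memv0 (inj a 0) ?mem0v ?La0 ?mulr0.
Qed.

Theorem theorem2p1 (K : fieldType) (charK0 : [pchar K] =i pred0)
    (n : nat) (n_gt0 : (0 < n)%N)
    (G : comFalgType K) (gr : nat -> {vspace G}) (D : nat)
    (G_std : standard_graded gr D)
    (G_codim : \dim (gr 1%N) = n)
    (I : idealr {mpoly K[n]}) (phi : {lrmorphism {ideal_quot I} -> G})
    (G_pres : graded_presentation gr phi)
    (G_gor : gorenstein gr D)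
    (G_wlp : weak_lefschetz gr D)
    (l : 'I_n) :
  (* x_neq0 only makes the quotient A = G / (0 :_G x_l) a MathComp type *)
  let x_neq0 := var_image_neq0 l G_codim G_pres in
  let grA : nat -> {vspace ann_quot x_neq0} := quot_grading x_neq0 gr in
  exists D' : nat,
    [/\ standard_graded grA D',
        gorenstein grA D'
      & \dim (grA 1%N) = \dim (gr 1%N) ->
        let k := D./2 in
        (odd D -> weak_lefschetz grA D') /\
        (~~ odd D -> \dim (gr k.-1) = \dim (gr k) -> weak_lefschetz grA D')].
Proof.
move=> x_neq0 grA.
have x1 : var_image phi l \in gr 1%N.
  apply/(presentation_grading G_pres); exists 'X_l => //.
  by rewrite dhomogX; apply/eqP; exact: mdeg1.
have [L L1 rankL] := G_wlp.
exists D.-1; split; first exact: quot_standard_graded.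
  exact: quot_gorenstein.
move=> _ k; have D_half := odd_double_half D; split=> [D_odd | D_even dim_k].
  have DE : D = k.*2.+1 by rewrite -[LHS]D_half D_odd.
  apply: (quot_weak_lefschetz G_std G_gor x_neq0 x1 L1 (m := k)) => //.
    by rewrite DE.
  apply: (maximal_rank_surjective G_std) => //.
    by apply: rankL; rewrite DE ltnS -addnn leq_addr.
  (* Degrees [k.+1] and [k] are complementary, as [D = 2k + 1]. *)
  by apply: (dim_complementary_le G_std G_gor); rewrite addSn addnn.
have DE : D = k.*2 by rewrite -[LHS]D_half (negPf D_even).
(* A nonzero [x] of degree one forces [D > 0], so [k.-1] is a true predecessor and
   [2(k - 1) <= D - 1]. *)
have k_gt0 : (0 < k)%N.
  by rewrite -double_gt0 -DE (socle_degree_gt0 G_std x_neq0 x1).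
apply: (quot_weak_lefschetz G_std G_gor x_neq0 x1 L1 (m := k.-1)) => //.
  by rewrite DE -(prednK k_gt0).
apply: (maximal_rank_surjective G_std) => //.
  by apply: rankL; rewrite DE prednK // -addnn leq_addr.
by rewrite prednK // dim_k.
Qed.
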